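(* For every constant integer $r\ge 1$ there exist an unweighted planar directed graph $G=(V,E)$ and a set $X\subseteq E$ of $r$ edges such that $X$ is shattered by the family $\overrightarrow{\mathcal{SP}}(G)=\{\tau_v: v\in V\}$ of subsets of $E$, where $\tau_v$ is the (edge set of the) shortest path tree of $G$ rooted at $v$.
   Context: For $v\in V$, $\tau_v$ is an out-tree rooted at $v$ consisting of shortest directed paths from $v$ to all vertices reachable from $v$; ties among shortest paths are broken consistently across all roots. A set $X\subseteq E$ is shattered by a family $\mathcal{F}$ of subsets of $E$ if $\{X\cap F: F\in\mathcal{F}\}=2^X$. *)

(* Defs.v *)
From HB Require Import structures.
From mathcomp Require Import all_boot all_order all_algebra.
From mathcomp Require Import classical_sets reals topology normedtype.

Set Implicit Arguments.
Unset Strict Implicit.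
Unset Printing Implicit Defensive.

Import Order.TTheory GRing.Theory Num.Theory.
Import numFieldNormedType.Exports.
Local Open Scope ring_scope.

Record digraph := Digraph {
  vertex :> finType;
  arcs : {set vertex * vertex};
  arcs_irrefl : forall x, (x, x) \notin arcs }.

(* Antiparallel arcs, like any two distinct arcs, are drawn as internally
   disjoint curves; this does not affect planarity. *)
Record plane_drawing (R : realType) (G : digraph)
    (pos : G -> R * R) (curve : G * G -> R -> R * R) : Prop := PlaneDrawing {
  drawing_pos_inj : injective pos;
  drawing_cont : forall e : G * G, e \in arcs G ->
    {within `[0, 1], continuous (curve e)}%classic;
  drawing_inj : forall e : G * G, e \in arcs G ->
    {in `[0, 1] &, injective (curve e)};
  drawing_source : forall e : G * G, e \in arcs G -> curve e 0 = pos e.1;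
  drawing_target : forall e : G * G, e \in arcs G -> curve e 1 = pos e.2;
  drawing_vertex : forall (e : G * G) (x : G) (t : R), e \in arcs G ->
    t \in `]0, 1[ -> curve e t <> pos x;
  drawing_disjoint : forall (e f : G * G) (s t : R), e \in arcs G -> f \in arcs G ->
    e <> f -> s \in `]0, 1[ -> t \in `]0, 1[ -> curve e s <> curve f t }.

Definition planar (R : realType) (G : digraph) : Prop :=
  exists (pos : G -> R * R) (curve : G * G -> R -> R * R),
    plane_drawing pos curve.

Definition arc_rel (V : finType) (T : {set V * V}) : rel V :=
  fun x y => (x, y) \in T.

(* As in the library, a walk is given by its first vertex x and the sequence p
   of the following ones. A walk of minimal length is a (simple) path. *)
Definition shortest_path (G : digraph) (x : G) (p : seq G) : Prop :=
  path (arc_rel (arcs G)) x p /\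
  forall q, path (arc_rel (arcs G)) x q -> last x q = last x p ->
    (size p <= size q)%N.

(* Out-tree rooted at v, given by its arc set: all arcs can be reached from v,
   and no vertex is reached from v by two distinct directed walks. *)
Definition out_tree (V : finType) (v : V) (T : {set V * V}) : Prop :=
  (forall a b, (a, b) \in T -> connect (arc_rel T) v a) /\
  (forall p q, path (arc_rel T) v p -> path (arc_rel T) v q ->
     last v p = last v q -> p = q).

Record shortest_path_tree (G : digraph) (v : G) (T : {set G * G}) : Prop :=
  ShortestPathTree {
  spt_sub : T \subset arcs G;
  spt_tree : out_tree v T;
  spt_shortest : forall p, path (arc_rel T) v p -> shortest_path v p;
  spt_span : forall w, connect (arc_rel (arcs G)) v w ->
    connect (arc_rel T) v w }.

(* tau is a choice of one shortest path tree per root. Ties are broken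
   consistently when any two of these trees that both contain a directed path
   from x to y contain the same one. *)
Record consistent_spts (G : digraph) (tau : G -> {set G * G}) : Prop :=
  ConsistentSpts {
  spts_tree : forall v, shortest_path_tree v (tau v);
  spts_consistent : forall u v x p q,
    path (arc_rel (tau u)) x p -> path (arc_rel (tau v)) x q ->
    last x p = last x q -> p = q }.

Definition sp_family (G : digraph) (tau : G -> {set G * G}) :
  {set {set G * G}} := [set tau v | v : G]%SET.

Definition shattered (T : finType) (X : {set T}) (F : {set {set T}}) : Prop :=
  [set X :&: A | A in F]%SET = powerset X.

(* Nonvacuity of consistent_spts: from x, walk to y through the first
   out-neighbour, in the enumeration of the vertices, that is closer to y. *)
Section ConsistentSptsExist.
Variable G : digraph.
Implicit Types (x y z v w : G) (p q : seq G).
Local Notation e := (arc_rel (arcs G)).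

Local Definition walkb x y n :=
  [exists p : n.-tuple G, path e x p && (last x p == y)].
Local Definition dist x y := find (walkb x y) (iota 0 #|G|).

Local Lemma dist_le x p : path e x p -> (dist x (last x p) <= size p)%N.
Proof.
move=> pp; have [sp|] := ltnP (size p) #|G|; last first.
  by apply: leq_trans; rewrite -[X in (_ <= X)%N](size_iota 0) find_size.
rewrite leqNgt; apply/negP => /(before_find 0%N).
rewrite nth_iota // add0n /walkb => /existsP; apply.
by exists (in_tuple p); rewrite pp /=.
Qed.

Local Lemma dist_walk x y : connect e x y ->
  exists p, [/\ path e x p, last x p = y & size p = dist x y].
Proof.
case/connectP=> p0 pp0 ->{y}; case/shortenP: pp0 => p pp /card_uniqP up _.
have hs : has (walkb x (last x p)) (iota 0 #|G|).
  apply/hasP; exists (size p); last first.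
    by rewrite /walkb; apply/existsP; exists (in_tuple p); rewrite pp /=.
  by rewrite mem_iota /= add0n -[(_ < _)%N]/(size (x :: p) <= _)%N -up max_card.
have := nth_find 0%N hs; rewrite -/(dist _ _).
rewrite nth_iota ?add0n; last by rewrite -[X in (_ <= X)%N](size_iota 0) -has_find.
by rewrite /walkb => /existsP[q /andP[pq /eqP lq]]; exists q; rewrite size_tuple.
Qed.

Local Definition closer x y z :=
  [&& e x z, connect e z y & (dist z y).+1 == dist x y].
Local Definition next x y :=
  fintype.arg_min x (closer x y) (fun z => enum_rank z : nat).
Local Fixpoint walk n x y :=
  if n is n'.+1 then next x y :: walk n' (next x y) y else [::].
Local Definition sel x y := walk (dist x y) x y.

Local Lemma dist0 x : dist x x = 0%N.
Proof. by apply/eqP; rewrite -leqn0; apply: (@dist_le x [::]). Qed.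

Local Lemma sel0 x : sel x x = [::]. Proof. by rewrite /sel dist0. Qed.

Local Lemma distS x y n : connect e x y -> dist x y = n.+1 ->
  exists z, closer x y z.
Proof.
move=> cxy dn; have [[|z p] [/= pp lp sp]] := dist_walk cxy.
  by move: sp; rewrite dn.
case/andP: pp => exz pp; exists z.
have czy : connect e z y by apply/connectP; exists p.
rewrite /closer exz czy /= eqn_leq; apply/andP; split.
  by rewrite -sp ltnS -lp dist_le.
have [q [pq lq <-]] := dist_walk czy.
by have := @dist_le x (z :: q); rewrite /= exz pq lq; apply.
Qed.

Local Lemma nextP x y z0 : closer x y z0 ->
  closer x y (next x y) /\
  forall z, closer x y z -> (enum_rank (next x y) <= enum_rank z)%N.
Proof.
move=> cz0; rewrite /next /fintype.arg_min /extremum.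
case: pickP => [z /andP[cz /forallP mz]|]; first split=> // z' cz'.
  by have /implyP := mz z'; apply.
have [z cz mz] := @arg_minnP _ z0 (closer x y) (fun z => enum_rank z) cz0.
move/(_ z); rewrite inE cz => /forallP[z']; exact/implyP/mz.
Qed.

Local Lemma next_uniq x y z : closer x y z ->
  (forall z', closer x y z' -> (enum_rank z <= enum_rank z')%N) -> next x y = z.
Proof.
move=> cz mz; have [cn mn] := nextP cz.
by apply/enum_rank_inj/val_inj/eqP; rewrite eqn_leq mn // mz.
Qed.

Local Lemma selS x y n : connect e x y -> dist x y = n.+1 ->
  closer x y (next x y) /\ sel x y = next x y :: sel (next x y) y.
Proof.
move=> cxy dn; have [z /nextP[cn _]] := distS cxy dn; split=> //.
by case/and3P: cn => _ _ /eqP dz; rewrite {1}/sel -dz.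
Qed.

Local Lemma selP x y : connect e x y ->
  [/\ path e x (sel x y), last x (sel x y) = y & size (sel x y) = dist x y].
Proof.
have [n] := ubnP (dist x y); elim: n x => // n IHn x ltn cxy.
case dn: (dist x y) => [|m].
  have [[|z p] [_ /= lp]] := dist_walk cxy; rewrite dn // => _.
  by rewrite -lp sel0.
have [/and3P[exz czy /eqP dz] ->] := selS cxy dn.
have [|pz lz sz] := IHn _ _ czy; first by rewrite -ltnS dz.
by rewrite /= exz pz lz sz dz dn.
Qed.

Local Lemma dist_tri x y z : connect e x y -> connect e y z ->
  (dist x z <= dist x y + dist y z)%N.
Proof.
move=> /dist_walk[p [pp lp <-]] /dist_walk[q [pq lq <-]].
rewrite -size_cat; have := @dist_le x (p ++ q).
by rewrite cat_path last_cat lp pp pq lq; apply.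
Qed.

Local Lemma sel_cons x y z q : connect e x y -> sel x y = z :: q ->
  [/\ next x y = z, closer x y z & sel z y = q].
Proof.
move=> cxy; case dn: (dist x y) => [|n]; first by rewrite /sel dn.
by have [cn ->] := selS cxy dn; case=> <- <-.
Qed.

Local Lemma sel_suffix x y p q : connect e x y -> sel x y = p ++ q ->
  connect e (last x p) y /\ sel (last x p) y = q.
Proof.
elim: p x => // z p IHp x cxy /= /(sel_cons cxy)[_ /and3P[_ czy _]].
exact: IHp.
Qed.

Local Lemma sel_prefix x y p q : connect e x y -> sel x y = p ++ q ->
  sel x (last x p) = p.
Proof.
elim: p x => [|z p IHp] x cxy /=; first by rewrite sel0.
move=> sxy; have [nz /and3P[exz czy /eqP dz] szy] := sel_cons cxy sxy.
have szw := IHp _ czy szy; set w := last z p in szw *.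
have [pzy lzy ssz] := selP czy.
have [cwy swy] := sel_suffix czy szy; rewrite -/w in cwy swy.
have [_ _ sswy] := selP cwy.
have czw : connect e z w.
  apply/connectP; exists p => //.
  by move: pzy; rewrite szy cat_path => /andP[].
have cxw : connect e x w by apply: connect_trans czw; exact: connect1.
have [_ _ sszw] := selP czw; rewrite szw in sszw.
have dzyE : dist z y = (dist z w + dist w y)%N.
  by rewrite -ssz szy size_cat sszw -sswy swy.
have dxw : dist x w = (dist z w).+1.
  apply/eqP; rewrite eqn_leq; apply/andP; split.
    rewrite -add1n; apply: leq_trans (dist_tri (connect1 exz) czw) _.
    rewrite leq_add2r; have := @dist_le x [:: z]; rewrite /= exz; exact.
  rewrite -(leq_add2r (dist w y)) addSn -dzyE dz; exact: dist_tri.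
have cn : closer x w z by rewrite /closer exz czw dxw eqxx.
have nw : next x w = z.
  apply: next_uniq => // z' /and3P[exz' cz'w /eqP dz'].
  have [|_] := @nextP x y z; first by rewrite /closer exz czy dz eqxx.
  rewrite nz; apply; rewrite /closer exz'.
  have cz'y := connect_trans cz'w cwy; rewrite cz'y /= eqn_leq.
  apply/andP; split.
    rewrite -dz ltnS dzyE; apply: leq_trans (dist_tri cz'w cwy) _.
    by rewrite leq_add2r -ltnS dz' dxw.
  rewrite -add1n; apply: leq_trans (dist_tri (connect1 exz') cz'y) _.
  rewrite leq_add2r; have := @dist_le x [:: z']; rewrite /= exz'; exact.
by have [_ ->] := selS cxw dxw; rewrite nw szw.
Qed.

Local Definition tau v : {set G * G} :=
  [set ab : G * G | [&& connect e v ab.1, connect e v ab.2 &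
                        sel v ab.2 == rcons (sel v ab.1) ab.2]]%SET.

Local Lemma tau_path v p :
  path (arc_rel (tau v)) v p <-> connect e v (last v p) /\ sel v (last v p) = p.
Proof.
elim/last_ind: p => [|p b [IH1 IH2]] /=; first by rewrite sel0.
rewrite last_rcons rcons_path; split=> [/andP[/IH1[_ sp]]|[cvb sb]].
  by rewrite /arc_rel inE /= sp => /and3P[_ ? /eqP].
have sb' : sel v b = p ++ [:: b] by rewrite cats1.
have sp := sel_prefix cvb sb'.
have [pvb _ _] := selP cvb.
have cvp : connect e v (last v p).
  by apply/connectP; exists p => //; move: pvb; rewrite sb' cat_path => /andP[].
by rewrite IH2 //= /arc_rel inE /= cvp cvb sp sb eqxx.
Qed.

Local Lemma tau_seg v x p : path (arc_rel (tau v)) x p ->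
  sel x (last x p) = p.
Proof.
case: p => [|b p] pp; first by rewrite /= sel0.
have cvx : connect e v x.
  by move: pp => /= /andP[+ _]; rewrite /arc_rel inE => /and3P[].
have [_ lx _] := selP cvx.
have px : path (arc_rel (tau v)) v (sel v x) by apply/tau_path; rewrite lx.
have /tau_path[cl sl] : path (arc_rel (tau v)) v (sel v x ++ b :: p).
  by rewrite cat_path px lx.
rewrite last_cat lx in cl sl.
by have [_] := sel_suffix cl sl; rewrite lx.
Qed.

Lemma consistent_spts_exist :
  exists tau : G -> {set G * G}, consistent_spts tau.
Proof.
exists tau; split=> [v|u v x p q /tau_seg up /tau_seg vq le]; last first.
  by rewrite -up le vq.
have tauv x : connect e v x -> connect (arc_rel (tau v)) v x.
  move=> cvx; have [_ lx _] := selP cvx; apply/connectP; exists (sel v x) => //.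
  by apply/tau_path; rewrite lx.
split=> //.
- apply/fintype.subsetP => -[a b]; rewrite inE /= => /and3P[ca cb /eqP sb].
  have [_ la _] := selP ca; have [+ _ _] := selP cb.
  by rewrite sb rcons_path la => /andP[].
- split=> [a b|p q /tau_seg vp /tau_seg vq le]; last by rewrite -vp le vq.
  by rewrite inE /= => /and3P[ca _ _]; apply: tauv.
- move=> p /tau_path[cp sp]; have [pp _ ssp] := selP cp.
  rewrite sp in pp ssp; split=> // q pq lq.
  by rewrite ssp -lq; exact: dist_le.
Qed.

End ConsistentSptsExist.

(* Main.v *)
Require Import Defs.
From HB Require Import structures.
From mathcomp Require Import all_boot all_order all_algebra.
From mathcomp Require Import classical_sets reals topology normedtype.
From mathcomp Require Import zify lra.

Set Implicit Arguments.
Unset Strict Implicit.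
Unset Printing Implicit Defensive.

Import Order.TTheory GRing.Theory Num.Theory.
Import numFieldNormedType.Exports.

(** The tree rooted at [v] contains the arc [(a, b)] when every shortest path
  from [v] to [b] ends with it, so that if [a] and [c] are the only
  in-neighbours of [b] it suffices to compare the distances from [v] to [a] and
  to [c]. Put [2 ^ r] sources on a horizontal line and, further right on this
  line, [r] sinks [b_i], each entered by one arc from above and by one from
  below. In each half plane the sources are joined to the sinks by a directed
  grid: columns go up from the sources, row [i] goes right and then turns down
  to [b_i], the turns being nested. The stretches of the rows are weighted by
  rectangular bumps. As long as these weights decrease with [i], the distance
  from source [j] to sink [i] is realized by climbing to row [i] and following
  it, so that it is essentially an arbitrary function of [(i, j)] plus a fixed
  strictly Monge one. As both half planes use the same Monge term, which of the
  two sides is closer can be prescribed independently for each [(i, j)].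
  Everything lives on the integer lattice with unit arcs, hence is planar. *)

(** * Unit-segment drawings on the integer lattice *)

Section GridDrawing.
Local Open Scope ring_scope.
Variable R : realType.
Implicit Types (a b c d : int) (s t : R).

Definition seg (a b : int) (t : R) : R := a%:~R + t * (b%:~R - a%:~R).

Definition int_adj (a b : int) : Prop := b = a + 1 \/ a = b + 1.

Definition grid_adj (p q : int * int) : Prop :=
  p.1 = q.1 /\ int_adj p.2 q.2 \/ p.2 = q.2 /\ int_adj p.1 q.1.

Lemma segxx a t : seg a a t = a%:~R.
Proof. by rewrite /seg subrr mulr0 addr0. Qed.

Lemma seg_between a b t : int_adj a b -> t \in `]0, 1[ ->
  exists2 m : int, m%:~R < seg a b t < (m + 1)%:~R &
    a = m /\ b = m + 1 \/ b = m /\ a = m + 1.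
Proof.
rewrite in_itv /= => -[->|->] /andP[t0 t1].
  by exists a; [rewrite /seg !rmorphD /=; lra | left].
by exists b; [rewrite /seg !rmorphD /=; lra | right].
Qed.

Lemma seg_neq_int a b c t : int_adj a b -> t \in `]0, 1[ ->
  seg a b t <> c%:~R.
Proof.
move=> /seg_between /[apply] -[m mt _] tE.
by move: mt; rewrite tE !ltr_int; lia.
Qed.

(** Open unit intervals with integer ends that meet have the same floor, hence the same ends. *)
Lemma seg_meet a b c d s t : int_adj a b -> int_adj c d ->
  s \in `]0, 1[ -> t \in `]0, 1[ -> seg a b s = seg c d t ->
  a = c /\ b = d \/ a = d /\ b = c.
Proof.
move=> ab cd s01 t01 E.
have [m /andP[ms sm] mE] := seg_between ab s01.
have [n /andP[nt tn] nE] := seg_between cd t01.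
have /[!ltr_int] : m%:~R < (n + 1)%:~R :> R by apply: lt_trans tn; rewrite -E.
have /[!ltr_int] : n%:~R < (m + 1)%:~R :> R by apply: lt_trans sm; rewrite E.
lia.
Qed.

(** Arcs are drawn as unit segments. Interiors of perpendicular ones never meet, and those of
    parallel ones only if both ends are shared; asymmetry then rules out opposite orientations. *)
Lemma grid_planar (G : digraph) (g : G -> int * int) :
  injective g ->
  (forall u v, (u, v) \in arcs G -> grid_adj (g u) (g v)) ->
  (forall u v, (u, v) \in arcs G -> (v, u) \notin arcs G) ->
  planar R G.
Proof.
move=> g_inj g_adj G_asym.
pose pos u : R * R := ((g u).1%:~R, (g u).2%:~R).
pose curve (e : G * G) t : R * R :=
  (seg (g e.1).1 (g e.2).1 t, seg (g e.1).2 (g e.2).2 t).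
have g_eq u v : (g u).1 = (g v).1 -> (g u).2 = (g v).2 -> u = v.
  by move=> E1 E2; apply: g_inj; apply: injective_projections.
exists pos, curve; split.
- move=> u v [/eqP + /eqP]; rewrite !eqr_int => /eqP E1 /eqP E2.
  exact: g_eq.
- move=> e _; apply: continuous_subspaceT => t.
  have seg_cont a b : continuous (seg a b).
    move=> z; apply: cvgD; first exact: cvg_cst.
    by apply: cvgM; [exact: cvg_id | exact: cvg_cst].
  exact: (cvg_pair (seg_cont _ _ t) (seg_cont _ _ t)).
- move=> [u v] /g_adj /= uv s t _ _ [].
  have seg_inj a b : int_adj a b -> seg a b s = seg a b t -> s = t.
    by rewrite /seg => -[->|->]; rewrite rmorphD /=; lra.
  by case: uv => -[_ ab] E1 E2; apply: seg_inj ab _.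
- by move=> e _; rewrite /curve /pos /seg !mul0r !addr0.
- by move=> e _; rewrite /curve /pos /seg !mul1r !subrKC.
- move=> [u v] x t /g_adj /= uv t01 [E1 E2].
  by case: uv => -[_ ab]; [move: E2 | move: E1]; apply: seg_neq_int.
- move=> [u v] [u' v'] s t uv uv' ne s01 t01 [/= E1 E2].
  have [[e1 a1]|[e1 a1]] := g_adj _ _ uv;
    have [[e2 a2]|[e2 a2]] := g_adj _ _ uv'.
  + move: E1; rewrite e1 e2 !segxx => /eqP; rewrite eqr_int => /eqP E1.
    case: (seg_meet a1 a2 s01 t01 E2) => -[F1 F2].
      by apply: ne; congr pair; apply: g_eq; rewrite // e1 e2.
    have uE : u = v' by apply: g_eq; rewrite // e1 E1.
    have vE : v = u' by apply: g_eq; rewrite // E1 -e2.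
    by have := G_asym _ _ uv; rewrite uE vE uv'.
  + by move: E1; rewrite e1 segxx => /esym; apply: seg_neq_int.
  + by move: E1; rewrite e2 segxx; apply: seg_neq_int.
  + move: E2; rewrite e1 e2 !segxx => /eqP; rewrite eqr_int => /eqP E2.
    case: (seg_meet a1 a2 s01 t01 E1) => -[F1 F2].
      by apply: ne; congr pair; apply: g_eq; rewrite // e1 e2.
    have uE : u = v' by apply: g_eq; rewrite // e1 E2.
    have vE : v = u' by apply: g_eq; rewrite // E2 -e2.
    by have := G_asym _ _ uv; rewrite uE vE uv'.
Qed.

End GridDrawing.

(** * Exact distances from a potential *)

Section Potential.
Variables (T : eqType) (e : rel T) (t : T) (D : pred T) (phi : T -> nat).

(** A walk to [t] stays in [D], and [phi] drops by at most one per arc. With [potential_descent],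
    which follows arcs that decrease [phi], this makes [phi] the distance to [t] on [D]. *)
Lemma potential_lower_bound :
  (forall x y, e x y -> D y -> D x && (phi x <= (phi y).+1)) ->
  D t -> phi t = 0 ->
  forall p x, path e x p -> last x p = t -> D x && (phi x <= size p).
Proof.
move=> De Dt phit; elim=> [|y p IHp] x /=; first by move=> _ ->; rewrite Dt phit.
case/andP=> exy /IHp /[apply] /andP[Dy le]; have /andP[-> /=] := De _ _ exy Dy.
by move/leq_trans; apply.
Qed.

Lemma potential_descent :
  (forall x, D x -> phi x = 0 -> x = t) ->
  (forall x n, D x -> phi x = n.+1 -> exists y, [/\ e x y, D y & phi y = n]) ->
  forall x, D x -> exists p, [/\ path e x p, last x p = t & size p = phi x].
Proof.
move=> D0 De x; move En: (phi x) => n; elim: n x En => [|n IHn] x phix Dx.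
  by exists [::]; split=> //; apply: D0.
have [y [exy /(IHn y) IHy /IHy[p [pp lp sp]]]] := De _ _ Dx phix.
by exists (y :: p); rewrite /= exy pp lp sp.
Qed.

End Potential.

(** * Distances in one half plane *)

(* In a half plane, a vertex [(j, a, i, k)] lies at abscissa [3 * j + a] and
   height [i * K + k]. Column [j] goes up if [j < N]; column [N + i] goes down
   from row [i]. Row [i] goes right along [k = 0] up to column [N + i]; between
   columns [j] and [j + 1] it makes a rectangular bump of height [c i j] over
   [a = 1, 2], so that this stretch has length [2 * c i j + 3]. *)
Section Half.
Variables (N r K : nat) (c : nat -> nat -> nat).

(** One unit up, with a carry from the last level of row [i] to row [i.+1]. *)
Definition above i k i' k' : bool :=
  (i' == i) && (k' == k.+1) || [&& i' == i.+1, k.+1 == K & k' == 0].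

Variant half_arc : nat -> nat -> nat -> nat -> nat -> nat -> nat -> nat -> Prop :=
| ArcUp j i k i' k' of j < N & above i k i' k' :
    half_arc j 0 i k j 0 i' k'
| ArcDown j i k i' k' of N <= j & above i' k' i k &
    (i < j - N) || (i == j - N) && (k == 0) : half_arc j 0 i k j 0 i' k'
| ArcEnter j i of j < N + i : half_arc j 0 i 0 j 1 i 0
| ArcBumpUp j i k of j < N + i & k < c i j : half_arc j 1 i k j 1 i k.+1
| ArcBumpTop j i of j < N + i : half_arc j 1 i (c i j) j 2 i (c i j)
| ArcBumpDown j i k of j < N + i & k < c i j : half_arc j 2 i k.+1 j 2 i k
| ArcLeave j i of j < N + i : half_arc j 2 i 0 j.+1 0 i 0.

Definition half_arcb (j a i k j' a' i' k' : nat) : bool :=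
  [|| [&& a == 0, a' == 0, j' == j, j < N & above i k i' k'],
      [&& a == 0, a' == 0, j' == j, N <= j, above i' k' i k &
          (i < j - N) || (i == j - N) && (k == 0)],
      [&& a == 0, a' == 1, j' == j, i' == i, k == 0, k' == 0 & j < N + i],
      [&& a == 1, a' == 1, j' == j, i' == i, k' == k.+1, k < c i j & j < N + i],
      [&& a == 1, a' == 2, j' == j, i' == i, k' == k, k == c i j & j < N + i],
      [&& a == 2, a' == 2, j' == j, i' == i, k == k'.+1, k' < c i j & j < N + i] |
      [&& a == 2, a' == 0, j' == j.+1, i' == i, k == 0, k' == 0 & j < N + i]].

Lemma half_arcP j a i k j' a' i' k' :
  reflect (half_arc j a i k j' a' i' k') (half_arcb j a i k j' a' i' k').
Proof.
apply: (iffP idP); last first.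
  by rewrite /half_arcb; case=> *; rewrite ?eqxx /=; lia.
rewrite /half_arcb; case/or4P=> [||| /or4P[]].
- by case/and5P=> /eqP-> /eqP-> /eqP-> *; constructor 1.
- by case/and5P=> /eqP-> /eqP-> /eqP-> ? /andP[*]; constructor 2.
- by case/and5P=> /eqP-> /eqP-> /eqP-> /eqP-> /and3P[/eqP-> /eqP-> *]; constructor 3.
- by case/and5P=> /eqP-> /eqP-> /eqP-> /eqP-> /and3P[/eqP-> *]; constructor 4.
- by case/and5P=> /eqP-> /eqP-> /eqP-> /eqP-> /and3P[/eqP-> /eqP-> *]; constructor 5.
- by case/and5P=> /eqP-> /eqP-> /eqP-> /eqP-> /and3P[/eqP-> *]; constructor 6.
- by case/and5P=> /eqP-> /eqP-> /eqP-> /eqP-> /and3P[/eqP-> /eqP-> *]; constructor 7.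
Qed.

Lemma half_arc_asym j a i k j' a' i' k' :
  half_arc j a i k j' a' i' k' -> half_arc j' a' i' k' j a i k -> False.
Proof.
case=> {j a i k j' a' i' k'} > *; match goal with
  H : half_arc _ _ _ _ _ _ _ _ |- _ => inversion H end; unfold above in *; lia.
Qed.

Variable i0 : nat.
Hypothesis c_dec : forall i j, i <= i0 -> c i0 j <= c i j.

Definition row_length j := \sum_(j <= l < N + i0) (2 * c i0 l + 3).

(* [half_ok] holds at the vertices from which the foot [(N + i0, 0, 0, 0)] of
   column [N + i0] can be reached, and [half_dist] is then the distance to it.
   As the rows get shorter with [i], from a column [j < N] it is optimal to
   climb to row [i0] at once. *)
Definition junction_ok j i k : bool :=
  if j < N then (i < i0) || (i == i0) && (k == 0)
  else [&& j <= N + i0, i == i0 & k == 0] || (j == N + i0) && (i < i0).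

Definition junction_dist j i k : nat :=
  if j < N then i0 * K - (i * K + k) + row_length j + i0 * K
  else if i == i0 then row_length j + i0 * K else i * K + k.

Definition half_ok j a i k : bool :=
  if a is 0 then junction_ok j i k
  else [&& junction_ok j.+1 i 0, k <= c i j & j < N + i].

Definition half_dist j a i k : nat :=
  match a with
  | 0 => junction_dist j i k
  | 1 => (c i j - k) + c i j + 2 + junction_dist j.+1 i 0
  | _ => k.+1 + junction_dist j.+1 i 0
  end.

Lemma row_lengthS j : j < N + i0 ->
  row_length j = 2 * c i0 j + 3 + row_length j.+1.
Proof. by move=> lt; rewrite /row_length big_ltn. Qed.

Lemma row_length0 : row_length (N + i0) = 0.
Proof. by rewrite /row_length big_geq. Qed.

(** [c_dec] serves for the arcs that enter a row: crossing to the next column on a row below [i0] is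
    at least as long as on row [i0], so it saves nothing. *)
Lemma half_dist_step j a i k j' a' i' k' : k < K -> k' < K ->
  half_arc j a i k j' a' i' k' -> half_ok j' a' i' k' ->
  half_ok j a i k && (half_dist j a i k <= (half_dist j' a' i' k').+1).
Proof.
have mulK x y : x < y -> x * K + K <= y * K.
  by move=> lt; rewrite addnC -mulSn leq_mul2r lt orbT.
have RS := row_lengthS; have R0 := row_length0.
rewrite /half_ok /half_dist /junction_ok /junction_dist => + + H.
case: H => {j a i k j' a' i' k'} [j i k i' k' jN|j i k i' k' Nj|j i ji|j i k ji kc|j i ji|j i k ji kc|j i ji] /=.
- rewrite jN /above => ab kK k'K; have := mulK i' i0; have := mulK i i0.
  case/orP: ab => [/andP[/eqP-> /eqP->]|/and3P[/eqP-> /eqP E /eqP->]]; lia.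
- rewrite [j < N]ltnNge Nj /above /= => ab le kK k'K.
  have Ki := mulK i i0; have Ki' := mulK i' i0.
  (* No other down column leads to this foot. On column [N + i0], [row_length] vanishes, so both
     branches of [junction_dist] agree at its top. *)
  have [jE|jN] := eqVneq j (N + i0); last first.
    by case: (eqVneq i' i0) => [i'E|]; lia.
  have ii0 : i' < i0 by lia.
  case: (eqVneq i' i0) ii0 => [->|_ ii0 _]; first by rewrite ltnn.
  case/orP: ab => [/andP[/eqP iE /eqP kE]|/and3P[/eqP iE /eqP kE /eqP k0]].
    by rewrite iE; case: eqVneq => [|_]; lia.
  have iK : i * K = i' * K + K by rewrite iE mulSn addnC.
  case: (eqVneq i i0) => [iE'|ne]; last by lia.
  by rewrite jE R0 -iE' iK; lia.
- move=> _ _ H; have Ki := mulK i i0; have RSj := RS j; have cj := @c_dec i j.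
  case: (ltnP j.+1 N) H => [jN|Nj] H.
    by rewrite (ltnW jN); lia.
  have iE : i = i0 by lia.
  rewrite iE eqxx in H *; case: ltnP => jN; lia.
- lia.
- lia.
- lia.
- lia.
Qed.

Lemma half_dist0 j a i k : a < 3 -> k < K ->
  half_ok j a i k -> half_dist j a i k = 0 ->
  [/\ j = N + i0, a = 0, i = 0 & k = 0].
Proof.
have RS := @row_lengthS j.
case: a => [|[|[|//]]] _ kK; rewrite /half_ok /half_dist /=; try by lia.
rewrite /junction_ok /junction_dist; case: ltnP => jN.
  by move=> _; have := RS; lia.
have iK0 : i * K = 0 -> i = 0.
  by move/eqP; rewrite muln_eq0 => /orP[/eqP //|]; lia.
case: (eqVneq i i0) iK0 => [-> iK0 H E|ne iK0 H E]; last by split; lia.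
have : i0 * K = 0 by lia.
by split; lia.
Qed.

(** The route climbs to row [i0], follows it, then goes down column [N + i0]; from a bump of a lower
    row it first finishes that bump. The bounds on [i0] and [c] keep each next vertex in range. *)
Lemma half_descent j a i k n : i0 < r -> (forall i j, c i j < K) ->
  j < N + r -> a < 3 -> i < r -> k < K ->
  half_ok j a i k -> half_dist j a i k = n.+1 ->
  exists j' a' i' k', [/\ [/\ j' < N + r, a' < 3, i' < r & k' < K],
    half_arc j a i k j' a' i' k', half_ok j' a' i' k' & half_dist j' a' i' k' = n].
Proof.
move=> i0r cK jr; case: a => [|[|[|//]]] _ ir kK.
- have mulK x y : x < y -> x * K + K <= y * K.
    by move=> lt; rewrite addnC -mulSn leq_mul2r lt orbT.
  have enter : i = i0 -> k = 0 -> j < N + i0 -> half_dist j 0 i k = n.+1 ->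
    exists j' a' i' k', [/\ [/\ j' < N + r, a' < 3, i' < r & k' < K],
      half_arc j 0 i k j' a' i' k', half_ok j' a' i' k' & half_dist j' a' i' k' = n].
    move=> -> -> jN; rewrite /= /junction_dist eqxx row_lengthS // => E.
    exists j, 1, i0, 0; split; [split => //; lia | exact: ArcEnter | |].
      by rewrite /= /junction_ok; case: ifP; lia.
    rewrite /= /junction_dist eqxx; case: ifP => _; move: E; case: ifP => _; lia.
  move=> ok E; have [jN|Nj] := ltnP j N.
    move: (ok); rewrite /= /junction_ok jN => /orP[ii0|/andP[/eqP iE /eqP kE]]; last first.
      by apply: enter => //; lia.
    have Ki := mulK _ _ ii0; move: E; rewrite /= /junction_dist jN => E.
    have [kS|kS] := ltnP k.+1 K.
      exists j, 0, i, k.+1; split; [split => //; lia | | |].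
      + by apply: ArcUp => //; rewrite /above !eqxx.
      + by rewrite /= /junction_ok jN ii0.
      + by rewrite /= /junction_dist jN; lia.
    exists j, 0, i.+1, 0; split; [split => //; lia | | |].
    + by apply: ArcUp => //; rewrite /above; lia.
    + by rewrite /= /junction_ok jN; lia.
    + by rewrite /= /junction_dist jN mulSn; lia.
  have jN0 : (j < N) = false by lia.
  move: (ok); rewrite /= /junction_ok jN0 => ok'.
  have [jE|jE] := eqVneq j (N + i0); last by apply: enter => //; lia.
  have R0 : row_length j = 0 by rewrite jE row_length0.
  have {}E : i * K + k = n.+1.
    move: E; rewrite /= /junction_dist jN0 R0.
    by case: (eqVneq i i0) => [iE|//]; rewrite ?iE; lia.
  case: k => [|k] in kK ok ok' enter E *.
    case: i => [|i] in ir ok ok' enter E *; first by lia.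
    (* Going down from level 0 of row [i.+1] borrows: the next vertex is level [K.-1] of row [i]. *)
    exists j, 0, i, K.-1; split; [split => //; lia | | |].
    + by apply: ArcDown => //; rewrite /above; lia.
    + by rewrite /= /junction_ok jN0; lia.
    + rewrite /= /junction_dist jN0; have [|_] := eqVneq i i0; first lia.
      by move: E; rewrite mulSn; lia.
  exists j, 0, i, k; split; [split => //; lia | | |].
  + by apply: ArcDown => //; rewrite /above; lia.
  + by rewrite /= /junction_ok jN0; lia.
  + by rewrite /= /junction_dist jN0; have [|_] := eqVneq i i0; lia.
- rewrite /half_ok => /and3P[ok kc ji] E.
  have [kE|kE] := eqVneq k (c i j).
    exists j, 2, i, k; split => //; first by rewrite kE; apply: ArcBumpTop.
      by rewrite /half_ok ok ji kc.
    by move: E; rewrite /= kE; lia.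
  have ltkc : k < c i j by lia.
  exists j, 1, i, k.+1; split; [split => //; have := cK i j; lia | | |].
  + exact: ArcBumpUp.
  + by rewrite /half_ok ok ji ltkc.
  + by move: E; rewrite /=; lia.
- rewrite /half_ok => /and3P[ok kc ji] E.
  case: k => [|k] in kK kc E *.
    exists j.+1, 0, i, 0; split; [split => //; lia | | |] => //.
    + exact: ArcLeave.
    + by move: E; rewrite /=; lia.
  exists j, 2, i, k; split; [split => //; lia | | |].
  + exact: ArcBumpDown.
  + by rewrite /half_ok ok ji (ltnW kc).
  + by move: E; rewrite /=; lia.
Qed.

End Half.

(** * The whole graph and its shortest path trees *)

Section Graph.
Variables (N r K : nat) (c : bool -> nat -> nat -> nat).

Definition half_vertex : finType := ('I_(N + r) * 'I_3 * 'I_r * 'I_K.+1)%type.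
Definition gvertex : finType := ('I_(N + r) + bool * half_vertex)%type.

(* Sources [inl j], [j < N], feed both halves; the sinks are [inl (N + i)]. *)
Definition garc (u v : gvertex) : bool :=
  match u, v with
  | inl j, inr (_, (j', a, i, k)) =>
      [&& j' == j, j < N, a == 0 :> nat, i == 0 :> nat & k == 0 :> nat]
  | inr (_, (j, a, i, k)), inl j' =>
      [&& j' == j, N <= j, a == 0 :> nat, i == 0 :> nat & k == 0 :> nat]
  | inr (s, (j, a, i, k)), inr (s', (j', a', i', k')) =>
      (s == s') && half_arcb N K.+1 (c s) j a i k j' a' i' k'
  | inl _, inl _ => false
  end.

Lemma garc_asym u v : garc u v -> ~~ garc v u.
Proof.
case: u v => [j|[s [[[j a] i] k]]] [j'|[s' [[[j' a'] i'] k']]] //=.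
- by move=> /and3P[_ lt _]; apply/negP => /and3P[/eqP jE le _]; rewrite jE in lt; lia.
- by move=> /and3P[_ lt _]; apply/negP => /and3P[/eqP jE le _]; rewrite jE in lt; lia.
case/andP=> /eqP -> /half_arcP uv; apply/negP => /andP[_ /half_arcP].
exact: half_arc_asym uv.
Qed.

Lemma garc_irrefl (u : gvertex) : (u, u) \notin [set e | garc e.1 e.2].
Proof. by rewrite inE; apply/negP => uu; have := garc_asym uu; rewrite uu. Qed.

Definition ggraph : digraph := Digraph garc_irrefl.

(** The axis takes height 0, so both halves are shifted away from it by one, and the lower one is
    mirrored. *)
Definition gpos (u : ggraph) : int * int :=
  match u with
  | inl j => (Posz (3 * j), 0%R)
  | inr (s, (j, a, i, k)) =>
      (Posz (3 * j + a),
       if s then Posz (i * K.+1 + k).+1 else (- Posz (i * K.+1 + k).+1)%R)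
  end.

Lemma gpos_inj : injective gpos.
Proof.
have hgt (i i' k k' : nat) : k < K.+1 -> k' < K.+1 ->
    i * K.+1 + k = i' * K.+1 + k' -> i = i' /\ k = k'.
  by move=> kK k'K E; have := @edivn_eq K.+1 i k kK; rewrite E edivn_eq // => -[].
case=> [j|[s [[[j a] i] k]]] [j'|[s' [[[j' a'] i'] k']]] /= [].
- by move=> E; congr inl; apply: val_inj => /=; lia.
- by case: s' => _; lia.
- by case: s => _; lia.
move=> E1 E2; have := ltn_ord a; have := ltn_ord a' => ? ?.
have jE : j = j' by apply: val_inj => /=; lia.
have aE : a = a' by apply: val_inj => /=; lia.
have [sE hE] : s = s' /\ i * K.+1 + k = i' * K.+1 + k'.
  by case: s s' E2 => -[] E2; split=> //; lia.
have [iE kE] := hgt _ _ _ _ (ltn_ord k) (ltn_ord k') hE.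
by rewrite jE aE sE (val_inj iE) (val_inj kE).
Qed.

Lemma gpos_adj (u v : ggraph) : (u, v) \in arcs ggraph -> grid_adj (gpos u) (gpos v).
Proof.
rewrite inE /grid_adj /int_adj /=.
case: u v => [j|[s [[[j a] i] k]]] [j'|[s' [[[j' a'] i'] k']]] //=.
- case/and5P=> /eqP -> _ /eqP -> /eqP -> /eqP ->.
  by left; case: s'; lia.
- case/and5P=> /eqP -> _ /eqP -> /eqP -> /eqP ->.
  by left; case: s; lia.
case/andP=> /eqP <- /half_arcP; move: (c s) => cs.
have hgt i1 k1 i2 k2 : above K.+1 i1 k1 i2 k2 ->
    i2 * K.+1 + k2 = (i1 * K.+1 + k1).+1.
  case/orP=> [/andP[/eqP -> /eqP ->]|/and3P[/eqP -> /eqP [<-] /eqP ->]];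
  rewrite ?mulSn; lia.
case=> {j a i k j' a' i' k'} > => [_ /hgt ->|_ /hgt -> _|*|*|*|*|*];
  case: s; lia.
Qed.

Lemma ggraph_planar (R : realType) : planar R ggraph.
Proof.
apply: (grid_planar R gpos_inj gpos_adj) => u v.
by rewrite !inE; apply: garc_asym.
Qed.

Definition source (j : 'I_N) : ggraph := inl (lshift r j).
Definition sink (i : 'I_r) : ggraph := inl (rshift N i).
Definition port (s : bool) (i : 'I_r) : ggraph :=
  inr (s, (rshift N i, ord0, Ordinal (leq_ltn_trans (leq0n i) (ltn_ord i)), ord0)).

Lemma sink_pred (u : ggraph) i : (u, sink i) \in arcs ggraph ->
  exists s, u = port s i.
Proof.
rewrite inE /=; case: u => [//|[s [[[j a] i'] k]]].
case/and5P=> /eqP <- _ /eqP aE /eqP iE /eqP kE; exists s.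
by congr (inr (_, (_, _, _, _))); apply: val_inj.
Qed.

Lemma port_sink s i : (port s i, sink i) \in arcs ggraph.
Proof. by rewrite inE /= eqxx leq_addr. Qed.

(** One arc off the axis, [i * K.+1] arcs up and as many down, and the stretch of row [i] in
    between. *)
Definition port_dist s (i : 'I_r) j : nat :=
  (2 * (i * K.+1) + row_length N (c s) i j).+1.

Hypothesis c_dec : forall s i i' j, i <= i' < r -> c s i' j <= c s i j.
Hypothesis c_bound : forall s i j, c s i j < K.+1.

(** The vertices from which [port s i0] can be reached: sinks have no outgoing arc, and the other
    half leads only to sinks. *)
Let ok (s : bool) (i0 : 'I_r) (u : ggraph) : bool :=
  match u with
  | inl j => j < N
  | inr (s', (j, a, i, k)) => (s' == s) && half_ok N (c s) i0 j a i k
  end.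

Let gdist s (i0 : 'I_r) (u : ggraph) : nat :=
  match u with
  | inl j => (half_dist N K.+1 (c s) i0 j 0 0 0).+1
  | inr (_, (j, a, i, k)) => half_dist N K.+1 (c s) i0 j a i k
  end.

Let gdist_source s i j : gdist s i (source j) = port_dist s i j.
Proof. by rewrite /= /junction_dist ltn_ord /port_dist; lia. Qed.

Lemma port_dist_le s i (j : 'I_N) p : path (arc_rel (arcs ggraph)) (source j) p ->
  last (source j) p = port s i -> port_dist s i j <= size p.
Proof.
move=> pp lp; rewrite -gdist_source.
suff /(_ _ _ pp lp) /andP[//] : forall p x, path (arc_rel (arcs ggraph)) x p ->
  last x p = port s i -> ok s i x && (gdist s i x <= size p).
apply: potential_lower_bound => {p pp lp}.
- move=> u v; rewrite /arc_rel inE /=.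
  case: u v => [j1|[s1 [[[j1 a1] i1] k1]]] [j'|[s' [[[j' a'] i'] k']]] //=.
  + by case/and5P=> /eqP -> -> /eqP -> /eqP -> /eqP -> /andP[_ _] /=.
  + by case/and5P=> /eqP -> + _ _ _; lia.
  case/andP=> /eqP <- /half_arcP uv /andP[/eqP sE]; rewrite sE eqxx in uv *.
  apply: half_dist_step uv => //.
  by move=> i2 j2 le; apply: c_dec; rewrite le /=.
- rewrite /= eqxx /= /junction_ok ltnNge leq_addr /= eqxx leqnn /=; lia.
rewrite /= /junction_dist ltnNge leq_addr /= row_length0.
by case: eqP => [<-|].
Qed.

Lemma port_dist_path s i (j : 'I_N) : exists p,
  [/\ path (arc_rel (arcs ggraph)) (source j) p, last (source j) p = port s i
    & size p = port_dist s i j].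
Proof.
rewrite -gdist_source; apply: (@potential_descent _ _ _ (ok s i) (gdist s i)).
- case=> [//|[s' [[[j1 a1] i1] k1]]] /= /andP[/eqP -> /half_dist0].
  move=> /(_ K.+1 (ltn_ord _) (ltn_ord _)) /[apply] -[jE aE iE kE].
  by congr (inr (_, (_, _, _, _))); apply: val_inj.
- move=> [j1 n|[s' [[[j1 a1] i1] k1]] n] /=.
    move=> jN [E].
    have r0 : 0 < r by apply: leq_ltn_trans (ltn_ord i).
    exists (inr (s, (j1, ord0, Ordinal r0, ord0))); split => //=.
    + by rewrite /arc_rel inE /= eqxx jN.
    + by rewrite eqxx /= /junction_ok jN; lia.
  case/andP=> /eqP -> okx /(half_descent (ltn_ord i) (c_bound s) (ltn_ord j1)
    (ltn_ord a1) (ltn_ord i1) (ltn_ord k1) okx).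
  case=> j' [a' [i' [k' [[lj la li lk] uv oky E]]]].
  exists (inr (s, (Ordinal lj, Ordinal la, Ordinal li, Ordinal lk))); split => //=.
  + by rewrite /arc_rel inE /= eqxx /=; apply/half_arcP.
  + by rewrite eqxx.
- by rewrite /= ltn_ord.
Qed.

(** The tree must reach the sink through one of its two ports, and by minimality not through the
    farther one. The strict inequality leaves no tie. *)
Lemma spt_port (tau : ggraph -> {set ggraph * ggraph}) (j : 'I_N) i s :
  consistent_spts tau -> port_dist s i j < port_dist (~~ s) i j ->
  (port s i, sink i) \in tau (source j) /\
  (port (~~ s) i, sink i) \notin tau (source j).
Proof.
move=> /spts_tree /(_ (source j)) tree lt.
have [p [pp lp sp]] := port_dist_path s i j.
have pps : path (arc_rel (arcs ggraph)) (source j) (rcons p (sink i)).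
  by rewrite rcons_path pp lp; apply: port_sink.
have far q : path (arc_rel (tau (source j))) (source j) (rcons q (sink i)) ->
    last (source j) q <> port (~~ s) i.
  move=> /(spt_shortest tree) [qq min] lq.
  have := min _ pps; rewrite !last_rcons !size_rcons sp => /(_ erefl).
  move: qq; rewrite rcons_path => /andP[qq _].
  by have := port_dist_le qq lq; lia.
split; last first.
  apply/negP => inT; have [reach _] := spt_tree tree.
  have /connectP[q qq lq] := reach _ _ inT.
  by apply: (far q) => //; rewrite rcons_path qq -lq.
have /connectP[] : connect (arc_rel (tau (source j))) (source j) (sink i).
  apply: spt_span tree _ _; apply/connectP.
  by exists (rcons p (sink i)); rewrite ?last_rcons.
case/lastP=> [_ /= [E]|q x]; first by have := ltn_ord j; lia.
rewrite last_rcons => qq xE; rewrite -{x}xE in qq.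
have notfar := far _ qq.
move: qq; rewrite rcons_path => /andP[_ inT].
have /sink_pred[s' lq] := fintype.subsetP (spt_sub tree) _ inT.
move: inT notfar; rewrite /arc_rel lq.
by case: s s' {far lt lq sp lp} => -[].
Qed.

End Graph.

(** * Encoding a bit matrix in the bumps *)

Section Shatter.
Variables (N r : nat) (P : nat -> nat -> bool).

(** Value 1 is balance: 0 makes the upper row shorter by 2, and 2 makes it longer by 2. From column
    [N] on it is 1, where the telescoping ends. *)
Definition offset i j : nat := if j < N then if P i j then 0 else 2 else 1.

(* The bumps of the upper half telescope along a row to [offset i j], up to a
   term that does not depend on [P]; the lower half is the unperturbed
   reference. Since [offset] varies by at most 2, the term [4 * (r - i)] keeps
   the bumps decreasing in [i]. *)
Definition bump (s : bool) i j : nat :=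
  if j < N then
    4 * (r - i) + 2 + (if s then offset i j else 0) - (if s then offset i j.+1 else 0)
  else 0.

Lemma offset_le2 i j : offset i j <= 2.
Proof. by rewrite /offset; do 2?case: ifP. Qed.

Lemma bump_dec s i i' j : i <= i' < r -> bump s i' j <= bump s i j.
Proof.
case/andP=> ii' i'r; have [->//|ne] := eqVneq i i'.
have := offset_le2 i j; have := offset_le2 i j.+1.
have := offset_le2 i' j; have := offset_le2 i' j.+1.
by rewrite /bump; case: ifP => // _; case: s; lia.
Qed.

Lemma bump_bound s i j : bump s i j < (4 * r + 4).+1.
Proof.
have := offset_le2 i j; rewrite /bump; case: ifP => // _; case: s; lia.
Qed.

(** Downward induction on [j]: the differences [offset i l - offset i l.+1] telescope to
    [offset i j - 1], doubled by the two sides of each bump. *)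
Lemma row_length_bump i j : j <= N ->
  row_length N (bump true) i j + 2 = row_length N (bump false) i j + 2 * offset i j.
Proof.
move=> jN; move En: (N - j) => n; elim: n j jN En => [|n IHn] j jN En.
  have -> : j = N by lia.
  rewrite /offset ltnn; congr (_ + _); apply: eq_big_nat => l /andP[Nl _].
  by rewrite /bump ltnNge Nl.
have jN' : j < N by lia.
rewrite !(@row_lengthS _ _ _ j) ?ltn_addr //.
have IH : row_length N (bump true) i j.+1 + 2 =
  row_length N (bump false) i j.+1 + 2 * offset i j.+1 by apply: IHn => //; lia.
have bE s : bump s i j = 4 * (r - i) + 2 + (if s then offset i j else 0)
  - (if s then offset i j.+1 else 0) by rewrite /bump jN'.
(* The [+ 2] in [bump] absorbs [offset i j.+1], so the truncated subtraction is exact. *)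
by rewrite !bE; have := offset_le2 i j.+1; lia.
Qed.

Lemma spt_bump (tau : ggraph N r (4 * r + 4) bump -> _) (j : 'I_N) (i : 'I_r) :
  consistent_spts tau ->
  ((port N (4 * r + 4) bump true i, sink _ _ _ i) \in tau (source _ _ _ j)) = P i j.
Proof.
move=> tauP; have := @row_length_bump i j (ltnW (ltn_ord j)).
have spt s := spt_port bump_dec bump_bound (s := s) (i := i) (j := j) tauP.
rewrite /offset ltn_ord; case: P => E.
  by have [|-> //] := spt true; rewrite /port_dist /=; lia.
by have [|_ /negbTE -> //] := spt false; rewrite /port_dist /=; lia.
Qed.

End Shatter.

(** * Shattering by sources indexed by subsets *)

Theorem theorem1p6 (R : realType) (r : nat) (hr : (1 <= r)%N) :
  exists (G : digraph) (X : {set G * G}),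
    [/\ planar R G, X \subset arcs G, #|X| = r &
        forall tau : G -> {set G * G}, consistent_spts tau ->
          shattered X (sp_family tau)].
Proof.
(* One source per subset of ['I_r]; [P i j] is membership of [i] in the [j]-th subset, and the
   default of [nth] is met only for [j >= N]. *)
pose N := #|{: {set 'I_r}}|.
pose P i j := i \in [seq val x | x in nth finset.set0 (enum {: {set 'I_r}}) j].
pose G := ggraph N r (4 * r + 4) (bump N r P).
pose e (i : 'I_r) : G * G := (port N _ _ true i, sink _ _ _ i).
have e_inj : injective e by move=> i i' [_ /addnI /val_inj].
pose X := [set e i | i : 'I_r]%SET; exists G, X; split.
- exact: ggraph_planar.
- by apply/fintype.subsetP => _ /imsetP[i _ ->]; apply: port_sink.
- by rewrite card_imset // card_ord.
move=> tau tauP; apply/finset.setP => Y; rewrite powersetE; apply/imsetP/idP.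
  by case=> T _ ->; apply: subsetIl.
(* The tree of the source numbered by [S] meets [X] exactly in [Y]. *)
move=> YX; pose S := [set i | e i \in Y]%SET.
exists (tau (source _ _ _ (enum_rank S))); first exact: imset_f.
have eE i : (e i \in tau (source _ _ _ (enum_rank S))) = (e i \in Y).
  rewrite spt_bump // /P nth_enum_rank fintype.mem_image ?inE //; exact: val_inj.
apply/finset.setP => x; rewrite inE; have [/imsetP[i _ ->]|xX] /= := boolP (x \in X).
  by rewrite eE.
by apply/negbTE; apply: contra xX => /(fintype.subsetP YX).
Qed.
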